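(* Let $d\ge 1$ and let $n_1,\dots,n_d\ge 0$ be integers. Let $P_{n_1\times n_2\times\cdots\times n_d}(z)$ denote the domination polynomial of the $d$-dimensional king graph $K_{n_1\times n_2\times\cdots\times n_d}$. Then \[ P_{n_1\times n_2\times\cdots\times n_d}(-1) = (-1)^{\lceil n_1/2\rceil \lceil n_2/2\rceil\cdots\lceil n_d/2\rceil}. \]
   Context: For integers $n_1,\dots,n_d\ge 0$, the $d$-dimensional king graph $K_{n_1\times\cdots\times n_d}=(V,E)$ has vertex set $V=[n_1]\times\cdots\times[n_d]$, where $[k]=\{1,\dots,k\}$, and $(u,v)\in E$ if and only if $\max_{i\in[d]}|u_i-v_i|=1$ (equivalently, it is the strong product of paths on $n_1,\dots,n_d$ vertices). A dominating set of a graph $G=(V,E)$ is a subset $S\subseteq V$ such that every vertex of $V$ is in $S$ or has a neighbor in $S$. The domination polynomial of $G$ is $P_G(z)=\sum_{S\subseteq V,\ S\text{ dominating}} z^{|S|}$. *)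

(* Defs.v *)
From HB Require Import structures.
From mathcomp Require Import all_boot all_order all_algebra.
Set Implicit Arguments.
Unset Strict Implicit.
Unset Printing Implicit Defensive.
Import GRing.Theory Num.Theory.
Local Open Scope ring_scope.

Definition dominating (T : finType) (e : rel T) (S : {set T}) : bool :=
  [forall v, (v \in S) || [exists u in S, e v u]].

Definition domination_poly (T : finType) (e : rel T) : {poly int} :=
  \sum_(S : {set T} | dominating e S) 'X^#|S|.

(* [n_1] x ... x [n_d], with every coordinate shifted down by one: 'I_k is     *)
(* {0, ..., k-1}.  Only coordinate differences matter for adjacency.           *)
Definition king_vertex (d : nat) (n : 'I_d -> nat) : finType :=
  {dffun forall i : 'I_d, 'I_(n i)}.

(* `|a - b|%N is the distance |a - b| (the subtraction is in int), so this is  *)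
(* not affected by truncated subtraction.                                      *)
Definition king_adj (d : nat) (n : 'I_d -> nat) : rel (king_vertex n) :=
  fun u v => (\max_(i < d) `|(u i : nat) - (v i : nat)| == 1)%N.

Lemma king_adj_sym (d : nat) (n : 'I_d -> nat) : symmetric (@king_adj d n).
Proof.
by move=> u v; rewrite /king_adj; under eq_bigr do rewrite distnC.
Qed.

Lemma king_adj_irrefl (d : nat) (n : 'I_d -> nat) :
  irreflexive (@king_adj d n).
Proof.
by move=> u; rewrite /king_adj big1 // => i _; rewrite distnn.
Qed.

(* Main.v *)
(** Write [F(A, B)] for the sum of [(-1)^|S|] over the sets [S] included in [B]
    that meet the closed neighbourhood of every vertex of [A].  Inclusion-exclusion
    gives [F(A, B) = F(B, A)].  A vertex [a] can be dropped from [A] as soon as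
    the neighbourhood of another vertex of [A] is, within [B], included in that of
    [a]; by duality the same holds for [B].  Counting coordinates from 0, one
    removes in this way, first from [A] and then from [B], the vertices with a
    coordinate 1 (compare with the vertex having 0 there instead), then those with
    a coordinate 3 (compare with 2), and so on.  Only the vertices with all
    coordinates even remain; they are pairwise non-adjacent, so [S] has to be the
    set of all of them. *)
Require Import Defs.
From HB Require Import structures.
From mathcomp Require Import all_boot all_order all_algebra.
From mathcomp Require Import zify.
Set Implicit Arguments.
Unset Strict Implicit.
Unset Printing Implicit Defensive.
Import GRing.Theory Num.Theory.
Local Open Scope ring_scope.

Definition hits (T U : finType) (r : T -> U -> bool) (A : {set T})
    (S : {set U}) : bool :=
  [forall a in A, exists b in S, r a b].

Definition hit_sum (T U : finType) (r : T -> U -> bool) (A : {set T})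
    (B : {set U}) : int :=
  \sum_(S : {set U} | (S \subset B) && hits r A S) (-1) ^+ #|S|.

(** Expanding the product of [c x + 1], with [c x = -1] on [D] and [0] elsewhere, yields this sum;
    any point of [D] makes a factor vanish. *)
Lemma sum_sign_subsets (T : finType) (D : {set T}) :
  \sum_(C : {set T} | C \subset D) (-1) ^+ #|C| = (D == set0)%:R :> int.
Proof.
transitivity (\prod_(x : T) ((if x \in D then -1 else 0) + 1) : int).
  rewrite bigA_distr /= [LHS]big_mkcond /=; apply: eq_bigr => C _.
  rewrite -big_mkcond /=; case: ifP => [/subsetP sCD | /subsetPn[x Cx Dx]].
    by rewrite (eq_bigr (fun=> -1)) ?prodr_const // => x /sCD ->.
  by rewrite (bigD1 x) //= (negPf Dx) mul0r.
have [->|/set0Pn[x Dx]] := eqVneq D set0.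
  by rewrite big1 // => x _; rewrite inE add0r.
by rewrite (bigD1 x) //= Dx addNr mul0r.
Qed.

(* Inclusion-exclusion: both sides are the sum of [(-1)^(|S| + |C|)] over the
   pairs [S], [C] with no [r]-edge from [C] to [S]. *)
Lemma hit_sumC (T U : finType) (r : T -> U -> bool) A B :
  hit_sum r A B = hit_sum (fun b a => r a b) B A.
Proof.
have expand (V W : finType) (q : V -> W -> bool) (X : {set V}) (Y : {set W}) :
    hit_sum q X Y = \sum_(S : {set W} | S \subset Y) \sum_(C : {set V} |
      (C \subset X) && [forall a in C, forall b in S, ~~ q a b])
      (-1) ^+ #|S| * (-1) ^+ #|C|.
  rewrite /hit_sum big_mkcondr; apply: eq_bigr => S _.
  (* [D] collects the vertices of [X] missed by [S]. The indicator of [D] being empty is the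
     alternating sum over the subsets of [D]. *)
  pose D := [set a in X | [forall b in S, ~~ q a b]].
  rewrite -big_distrr /= (eq_bigl (fun C : {set V} => C \subset D)); last first.
    move=> C; apply/andP/subsetP => [[/subsetP CX /forall_inP CS] a Ca|CD].
      by rewrite inE CX ?CS.
    split; first by apply/subsetP => a /CD; rewrite inE => /andP[].
    by apply/forall_inP => a /CD; rewrite inE => /andP[].
  rewrite sum_sign_subsets; suff <- : hits q X S = (D == set0).
    by case: (hits q X S); rewrite ?mulr1 ?mulr0.
  apply/forall_inP/eqP => [hit|D0 a Xa].
    apply/setP => a; rewrite !inE; apply/negP => /andP[Xa /forall_inP aS].
    by have /exists_inP[b /aS /negP] := hit a Xa.
  have : a \notin D by rewrite D0 inE.
  rewrite inE Xa negb_forall_in => /exists_inP[b Sb /negPn qb].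
  by apply/exists_inP; exists b.
rewrite !expand (exchange_big_dep (fun C : {set T} => C \subset A)) /=.
  2: by move=> S C _ /andP[].
apply: eq_bigr => C CA; apply: eq_big => [S|S _]; last by rewrite mulrC.
rewrite CA; congr (_ && _).
apply/forall_inP/forall_inP => ind x xin; apply/forall_inP => y yin.
  by move/forall_inP: (ind y yin); apply.
by move/forall_inP: (ind y yin); apply.
Qed.

Lemma hit_sum_rows (T U : finType) (r : T -> U -> bool) (A A' : {set T})
    (B : {set U}) :
  A' \subset A ->
  (forall a, a \in A ->
     exists2 a', a' \in A' & {in B, forall b, r a' b -> r a b}) ->
  hit_sum r A B = hit_sum r A' B.
Proof.
move=> /subsetP sA'A dom; apply: eq_bigl => S; apply: andb_id2l => /subsetP sSB.
apply/forall_inP/forall_inP => hit a Aa; first exact/hit/sA'A.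
have [a' A'a' sub] := dom a Aa; have /exists_inP[b Sb rb] := hit a' A'a'.
by apply/exists_inP; exists b => //; apply: sub => //; apply: sSB.
Qed.

Lemma hit_sum_eq_on (T : finType) (r : rel T) (A : {set T}) :
  {in A &, forall a b, r a b = (a == b)} -> hit_sum r A A = (-1) ^+ #|A|.
Proof.
move=> rE; rewrite /hit_sum (big_pred1 A) // => S.
apply/andP/eqP => [[sSA /forall_inP hit]|->]; last first.
  by split=> //; apply/forall_inP => a Aa; apply/exists_inP; exists a; rewrite ?rE.
apply/eqP; rewrite eqEsubset sSA; apply/subsetP => a Aa.
have /exists_inP[b Sb] := hit a Aa.
by rewrite rE ?(subsetP sSA b Sb) // => /eqP ->.
Qed.

Definition king_closed (d : nat) (n : 'I_d -> nat) : rel (king_vertex n) :=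
  fun u v => [forall i, (`|(u i : nat) - (v i : nat)| <= 1)%N].

Lemma king_closedE d (n : 'I_d -> nat) (u v : king_vertex n) :
  king_closed u v = (u == v) || king_adj u v.
Proof.
have -> : king_closed u v = (\max_(i < d) `|(u i : nat) - (v i : nat)| <= 1)%N.
  by apply/forallP/bigmax_leqP => h i; move: (h i) => // /(_ isT).
rewrite leq_eqVlt ltnS leqn0 orbC; congr (_ || _).
apply/eqP/eqP => [h|->]; last by rewrite big1 // => i _; rewrite distnn.
apply/ffunP => i; apply/val_inj/eqP; rewrite /= -distn_eq0 -leqn0.
rewrite -[X in (_ <= X)%N]h.
exact: leq_bigmax.
Qed.

Lemma domination_king d (n : 'I_d -> nat) :
  (domination_poly (@king_adj d n)).[-1] = hit_sum (@king_closed d n) setT setT.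
Proof.
rewrite /domination_poly horner_sum; under eq_bigr do rewrite hornerXn.
apply: eq_bigl => S; rewrite subsetT; apply/forallP/forall_inP => dom v.
  move=> _; apply/exists_inP; have /orP[Sv|/exists_inP[u Su uv]] := dom v.
    by exists v; rewrite // king_closedE eqxx.
  by exists u; rewrite // king_closedE uv orbT.
have /exists_inP[u Su] := dom v (in_setT v); rewrite king_closedE.
case/orP=> [/eqP->|uv]; first by rewrite Su.
by rewrite orbC; apply/orP; left; apply/exists_inP; exists u.
Qed.

(** State after [k] rounds: the odd coordinates below [2k] are gone. *)
Definition core d (n : 'I_d -> nat) (k : nat) : {set king_vertex n} :=
  [set u : king_vertex n | [forall i, ~~ odd (u i) || (k.*2 <= u i)%N]].

(** Take for [u'] the vertex [u] with each coordinate [2k+1] lowered to [2k]. No coordinate in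
    [core n k] equals [2k-1], so one within 1 of [2k] is [2k] or [2k+1], hence within 1 of
    [2k+1]. *)
Lemma core_retract d (n : 'I_d -> nat) k (u : king_vertex n) : u \in core n k ->
  exists2 u', u' \in core n k.+1 &
    {in core n k, forall v, king_closed u' v -> king_closed u v}.
Proof.
rewrite inE => /forallP ku.
(* The default [u i] is harmless: [2k] is in range whenever [u i] is [2k+1]. *)
pose low i : 'I_(n i) := insubd (u i) k.*2.
have lowE i : u i = k.*2.+1 :> nat -> low i = k.*2 :> nat.
  by move=> ui; rewrite val_insubd; have := ltn_ord (u i); case: ifP; lia.
exists [ffun i => if (u i : nat) == k.*2.+1 then low i else u i].
  rewrite inE; apply/forallP => i; rewrite ffunE.
  case: eqP => [/lowE->|]; first by rewrite odd_double.
  by have := ku i; lia.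
move=> v; rewrite inE => /forallP kv /forallP uv; apply/forallP => i.
have := uv i; rewrite ffunE; case: eqP => // ui; rewrite lowE //.
by have := kv i; lia.
Qed.

Lemma core_sub d (n : 'I_d -> nat) k : core n k.+1 \subset core n k.
Proof.
apply/subsetP => u; rewrite !inE => /forallP uk; apply/forallP => i.
by have := uk i; lia.
Qed.

Lemma king_closed_sym d (n : 'I_d -> nat) : symmetric (@king_closed d n).
Proof. by move=> u v; apply: eq_forallb => i; rewrite distnC. Qed.

Lemma hit_sum_core d (n : 'I_d -> nat) k :
  hit_sum (@king_closed d n) (core n k) (core n k) =
  hit_sum (@king_closed d n) setT setT.
Proof.
elim: k => [|k <-].
  suff -> : core n 0 = setT by [].
  by apply/setP => u; rewrite !inE; apply/forallP => i; rewrite orbT.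
symmetry; rewrite (hit_sum_rows (core_sub n k)); last exact: core_retract.
(* After duality the other set shrinks by the same retraction; the points to compare with now lie in
   [core n k.+1], still inside [core n k]. *)
rewrite hit_sumC (hit_sum_rows (core_sub n k)) => [|u /core_retract[u' u'k sub]].
  by rewrite -hit_sumC.
exists u' => // v vk; rewrite ![king_closed v _]king_closed_sym; apply: sub.
exact: subsetP (core_sub n k) v vk.
Qed.

Lemma card_even_ord n : #|[set a : 'I_n | ~~ odd a]| = uphalf n.
Proof.
rewrite -sum1_card (eq_bigl (fun a : 'I_n => ~~ odd a)); last first.
  by move=> a; rewrite inE.
elim: n => [|n IHn]; first by rewrite big_ord0.
rewrite big_mkcond big_ord_recr -big_mkcond /= IHn uphalf_half.
by case: odd; rewrite ?addn0 // addn1.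
Qed.

Theorem theorem2 (d : nat) (n : 'I_d -> nat) (hd : (0 < d)%N) :
  (domination_poly (@king_adj d n)).[-1] =
  (-1) ^+ (\prod_(i < d) uphalf (n i))%N.
Proof.
(* Enough rounds for every coordinate to lie below [2k]. *)
pose k := \max_(i < d) n i.
have coreE u : (u \in core n k) = [forall i, ~~ odd (u i)].
  rewrite inE; apply: eq_forallb => i.
  have uk : (u i < k)%N := leq_trans (ltn_ord (u i)) (leq_bigmax i).
  suff -> : (k.*2 <= u i)%N = false by rewrite orbF.
  by move: uk; clearbody k; lia.
rewrite domination_king -(hit_sum_core n k) hit_sum_eq_on.
  congr (_ ^+ _); under eq_bigr do rewrite -card_even_ord.
  rewrite -cardsXn; apply: eq_card => u; rewrite coreE in_setXn.
  by apply: eq_forallb => i; rewrite inE.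
move=> u v; rewrite !coreE => /forallP eu /forallP ev.
apply/forallP/eqP => [uv|-> i]; last by rewrite distnn.
(* Two even numbers at distance at most 1 are equal. *)
apply/ffunP => i; apply: val_inj => /=; move: (uv i) (eu i) (ev i).
move: (nat_of_ord (u i)) (nat_of_ord (v i)) => a b.
lia.
Qed.
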